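(* For any partition $\rho$ (written $\rho=(\rho_1,\dots,\rho_{\ell(\rho)})$) and any positive integers $k$ and $m$, one has $$b^{k}_{\rho \cup (m)} = \delta_{m,1}\, b^k_{\rho} + 2 \sum_{1 \leq i \leq \ell(\rho)} \rho_i\, b^{k-1}_{\rho \setminus (\rho_{i}) \cup (\rho_{i}+m)} + \sum_{\substack{r+s=m \\ r,s \geq 1}} b^{k-1}_{\rho \cup (r,s)} + (m-1)\, b^{k-1}_{\rho \cup (m)},$$ where the sum over $r,s$ runs over ordered pairs $(r,s)$ of positive integers with $r+s=m$.
   Context: A partition $\lambda$ of $n\ge 0$ (written $\lambda\vdash n$) is a non-increasing finite sequence of positive integers (parts) with sum $n=|\lambda|$; $\ell(\lambda)$ is its number of parts. $\lambda\setminus(i)$ is the partition obtained by erasing one part equal to $i$, and $\lambda\cup(i)$, $\lambda\cup(i,j)$ are obtained by adding a part $i$, respectively parts $i$ and $j$ (and reordering). $\delta_{m,1}$ is the Kronecker delta. View $S_{2n}$ as the group of permutations of $\{1,\bar 1,\dots,n,\bar n\}$, with the convention $\overline{\bar i}=i$. The hyperoctahedral group $H_n\subset S_{2n}$ consists of the $\sigma$ with $\overline{\sigma(i)}=\sigma(\bar i)$ for all $i$. Put $p_n=\sum_{h\in H_n}h$. Coset-type: for $\sigma\in S_{2n}$, let $G_\sigma$ be the (multi)graph on vertex set $\{1,\bar1,\dots,n,\bar n\}$ with a solid edge between $i$ and $\bar i$ and a dashed edge between $\sigma(i)$ and $\sigma(\bar i)$ for each $i=1,\dots,n$. Every vertex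 has degree 2, and $G_\sigma$ is a disjoint union of cycles of even lengths $2\mu_1\ge 2\mu_2\ge\cdots$ (a solid and a dashed edge with the same endpoints form a cycle of length 2); the partition $\mu=(\mu_1,\mu_2,\dots)\vdash n$ is the coset-type of $\sigma$. Let $\mathcal{C}^{(2)}_\mu$ be the sum of all $\sigma\in S_{2n}$ of coset-type $\mu$. With the order $1<\bar1<2<\bar2<\cdots<n<\bar n$, the odd-indexed Jucys-Murphy elements are $$J^{(2)}_i=\sum_{j=1,\bar1,\dots,i-1,\overline{i-1}}(j\ i),\qquad 1\le i\le n .$$ They commute, and for every symmetric function $F$ the element $F(J^{(2)}_1,\dots,J^{(2)}_n)\,p_n$ is a linear combination of the $\mathcal{C}^{(2)}_\mu$, $\mu\vdash n$. Let $h_k$ denote the complete homogeneous symmetric function of degree $k$ ($h_0=1$). The coefficients $b^k_\mu$ are defined by $$h_k(J^{(2)}_1,\dots,J^{(2)}_n)\,p_n=\sum_{\mu\vdash n}b^k_\mu\,\mathcal{C}^{(2)}_\mu\qquad (n\ge 0),$$ with, for $n=0$, $b^k_\emptyset=\delta_{k,0}$. *)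

(* Defs.v *)
From HB Require Import structures.
From Stdlib Require Import ClassicalEpsilon.
From mathcomp Require Import all_boot all_order all_algebra all_fingroup.
From mathcomp Require Import mxrepresentation.

Set Implicit Arguments.
Unset Strict Implicit.
Unset Printing Implicit Defensive.

Import GRing.Theory.
Local Open Scope ring_scope.

Definition is_part (la : seq nat) : bool :=
  sorted geq la && all (fun p => 0 < p)%N la.

Definition is_part_of (n : nat) (la : seq nat) : bool :=
  is_part la && (sumn la == n).

Definition padd (la parts : seq nat) : seq nat := sort geq (parts ++ la).
Definition prem (la : seq nat) (p : nat) : seq nat := rem p la.

(* The points 1, \bar 1, ..., n, \bar n: (i, false) stands for i + 1 and
   (i, true) for \bar{i + 1}; their order is lexicographic. *)
Notation pt n := ('I_n * bool)%type.

Definition bar (n : nat) (x : pt n) : pt n := (x.1, ~~ x.2).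

Definition hyperoct (n : nat) : {set {perm pt n}} :=
  [set s : {perm pt n} | [forall x, bar (s x) == s (bar x)]].

Definition coset_edge (n : nat) (s : {perm pt n}) : rel (pt n) :=
  fun x y => (y == bar x) || [exists z, (x == s z) && (y == s (bar z))].

(* A component is a cycle of length 2 mu_j, hence has 2 mu_j vertices. *)
Definition coset_type (n : nat) (s : {perm pt n}) : seq nat :=
  sort geq [seq #|C|./2 | C : {set pt n} in
              equivalence_partition (connect (coset_edge s)) [set: pt n]].

(* The group algebra Q[S_2n] is the algebra of matrices spanned by the
   (faithful) regular representation; gset_mx is the sum of a set of group
   elements. *)
Notation galg n := 'M[rat]_#|[set: {perm pt n}]|.

Definition perm_elt (n : nat) (s : {perm pt n}) : galg n :=
  regular_repr rat [set: {perm pt n}] s.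

Definition p_elt (n : nat) : galg n :=
  gset_mx rat [set: {perm pt n}] (hyperoct n).

Definition coset_sum (n : nat) (mu : seq nat) : galg n :=
  gset_mx rat [set: {perm pt n}] [set s : {perm pt n} | coset_type s == mu].

Definition jm (n : nat) (i : 'I_n) : galg n :=
  \sum_(x : pt n | (x.1 < i)%N) perm_elt (tperm x (i, false)).

Definition complete_sym (R : pzRingType) (n k : nat) (x : 'I_n -> R) : R :=
  \sum_(t : k.-tuple 'I_n | sorted (relpre val leq) t) \prod_(i <- t) x i.

(* Permutations compose from right to left in h_k(J) p_n, whereas s * t means
   "first s, then t" for {perm _}: the factors appear in reverse order.
   A partition of n is encoded as a sequence of at most n parts, all at most
   n, so that the sum has a finite index type. *)
Definition h_coef_spec (b : nat -> seq nat -> rat) : Prop :=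
  forall n k : nat,
    p_elt n * complete_sym k (@jm n) =
    \sum_(mu : n.-bseq 'I_n.+1 | is_part_of n (map val mu))
       b k (map val mu) *: coset_sum n (map val mu).

(* The coset_sum n mu, for mu a partition of n, are linearly independent, so
   h_coef_spec determines b k mu for every partition mu; the case n = 0 gives
   b k [::] = (k == 0). *)
Definition h_coef : nat -> seq nat -> rat :=
  epsilon (inhabits (fun _ _ => 0)) h_coef_spec.

(* Main.v *)
(* The coefficient of sigma in p_n h_k(J) depends only on the fixed-point free
   involution tau = sigma^-1 bar sigma, whose orbits are the dashed edges of
   G_sigma.  Splitting h_k(J_1, ..., J_(n+1)) as
   h_k(J_1, ..., J_n) + h_(k-1)(J_1, ..., J_(n+1)) J_(n+1), the first summand
   contributes only if n+1 and its bar form a loop of their own, and the second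
   one is the sum over x < n+1 of the coefficients at the conjugates of tau by
   (x n+1).  If x lies on another loop, the conjugation merges the two loops; if
   it lies on the loop of n+1, half of the x split this loop and half of them
   reverse a segment of it.

   It remains to see that the coefficients depend on the coset-type only.  A
   permutation is determined up to H_n x H_n by its coset-type, so this amounts
   to the right H_n-invariance of p_n h_k(J).  By the same loop surgery, the
   coefficient of sigma in p_n e_k(J) is 1 if sigma has n - k loops and 0
   otherwise, so p_n e_k(J) is right H_n-invariant; hence so are the p_n h_k(J),
   by sum_j (-1)^j e_j h_(k-j) = 0 and because p_n X Y is right invariant as
   soon as p_n X and p_n Y are. *)
Require Import Defs.
From Stdlib Require Import ClassicalEpsilon.
From mathcomp Require Import all_boot all_order all_algebra all_fingroup.
From mathcomp Require Import mxrepresentation.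

Set Implicit Arguments.
Unset Strict Implicit.
Unset Printing Implicit Defensive.

Import GRing.Theory.
Local Open Scope ring_scope.

(** * Matchings and their loops *)

Lemma barK n : involutive (@bar n).
Proof. by case=> i b; rewrite /bar negbK. Qed.

Lemma bar_neq n (x : pt n) : bar x != x.
Proof. by case: x => i b; rewrite xpair_eqE eqxx; case: b. Qed.

Definition barp n : {perm pt n} := perm (can_inj (@barK n)).

Lemma barpE n x : barp n x = bar x.
Proof. by rewrite permE. Qed.

Lemma eq_bar n (x y : pt n) : (bar x == y) = (x == bar y).
Proof. by rewrite (can2_eq (@barK n) (@barK n)). Qed.

Lemma fst_eq n (x y : pt n) : x.1 = y.1 -> (x == y) || (x == bar y).
Proof. by case: x y => [i b] [j c] /= ->; rewrite !xpair_eqE eqxx; case: b c => [] []. Qed.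

(* Only the matching tau = sigma^-1 bar sigma matters: its dashed edges are
   {x, tau x}. *)
Definition matching n (t : {perm pt n}) := involutive t /\ forall x, t x != x.

Lemma conj_matching n (t s : {perm pt n}) : matching t -> matching (t ^ s)%g.
Proof.
move=> [tK tN]; split=> x; rewrite -[x](permKV s) !permJ ?tK //.
by rewrite (inj_eq perm_inj).
Qed.

Lemma barp_matching n : matching (barp n).
Proof. by split=> x; rewrite !barpE ?barK ?bar_neq. Qed.

Definition step n (t : {perm pt n}) (x : pt n) := t (bar x).

(* Every loop with 2 m vertices is recorded by the m vertices met after a
   dashed edge, for one of its two orientations. *)
Definition loops n (t : {perm pt n}) (L : seq (seq (pt n))) :=
  [&& [::] \notin L, all (fcycle (step t)) L
    & perm_eq (map fst (flatten L)) (enum 'I_n)].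

Section Loops.
Variable n : nat.
Implicit Types (t : {perm pt n}) (x y z a j : pt n) (c A B Y : seq (pt n)).
Implicit Types (L R : seq (seq (pt n))).

Lemma loops_uniq t L : loops t L -> uniq (map fst (flatten L)).
Proof. by case/and3P=> _ _ /perm_uniq->; rewrite enum_uniq. Qed.

Lemma uniq_fst_inj Y : uniq (map fst Y) -> {in Y &, injective fst}.
Proof.
move=> uY x y xY yY e.
have szY z : z \in Y -> (index z Y < size (map fst Y))%N.
  by rewrite size_map index_mem.
rewrite -(nth_index x xY) -(nth_index x yY); congr nth.
apply/eqP; rewrite -(nth_uniq x.1 (szY x xY) (szY y yY) uY).
by rewrite !(nth_map x) ?index_mem // !nth_index //; apply/eqP.
Qed.

Lemma uniq_fst_bar Y x y : uniq (map fst Y) -> x \in Y -> y \in Y -> x != bar y.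
Proof.
move=> uY xY yY; apply/eqP=> xy; have E : x = y.
  by apply: (uniq_fst_inj uY) => //; rewrite xy.
by move: (bar_neq y); rewrite -xy E eqxx.
Qed.

Lemma loops_cover t L x : loops t L -> (x \in flatten L) || (bar x \in flatten L).
Proof.
case/and3P=> _ _ /perm_mem/(_ x.1); rewrite mem_enum => /mapP[y yL /fst_eq].
by case/orP=> /eqP->; rewrite ?barK yL ?orbT.
Qed.

Lemma loops_perm t L R : perm_eq L R -> loops t L = loops t R.
Proof.
move=> LR; rewrite /loops (perm_mem LR) (perm_all _ LR); congr [&& _, _ & _].
by have /permPl-> := perm_map (@fst _ _) (perm_flatten LR).
Qed.

Lemma loops_rot t c R k : loops t (c :: R) -> loops t (rot k c :: R).
Proof.
rewrite /loops /= !inE !negb_or ![[::] == _]eq_sym -!size_eq0 size_rot rot_cycle.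
case/and3P=> -> -> /= H; apply: perm_trans H.
by apply: perm_map; rewrite /= perm_cat2r perm_rot.
Qed.

Lemma path_step_rev t x y c : matching t ->
  path (frel (step t)) x (rcons c y) ->
  path (frel (step t)) (bar y) (rcons (rev (map (@bar n) c)) (bar x)).
Proof.
move=> [tK _]; elim: c x y => [|z c IH] x y /=; rewrite ?andbT /step.
  by move=> /eqP <-; rewrite barK tK.
case/andP=> /eqP<- /IH.
rewrite rev_cons rcons_path => -> /=; rewrite last_rcons.
by rewrite /step barK tK.
Qed.

Lemma loops_flip t c R : matching t -> loops t (c :: R) ->
  loops t (rev (map (@bar n) c) :: R).
Proof.
move=> mt; case: c => [|x c] //.
rewrite /loops /= !inE !negb_or rev_cons; case/and3P=> /andP[_ ->] /andP[pc ->] pe.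
rewrite -rot1_cons [fcycle _ _]rot_cycle /= path_step_rev //.
rewrite [[::] == _]eq_sym -size_eq0 size_rot andbT /=; apply: perm_trans pe.
rewrite rot1_cons map_cat /= map_cat -cat_cons perm_cat2r map_rcons perm_rcons.
by rewrite perm_cons map_rev perm_rev -map_comp.
Qed.

(** A loop that contains [bar x] instead of [x] is first read in its other orientation; then it is
    rotated until [x] comes first. *)
Lemma loops_expose t L x : matching t -> loops t L ->
  exists c R, loops t ((x :: c) :: R) /\
              perm_eq (map size L) (map size ((x :: c) :: R)).
Proof.
move=> mt lL.
wlog xL : L lL / x \in flatten L => [hw|].
  case/orP: (loops_cover x lL) => [|xL]; first exact: hw.
  case/flattenP: (xL) => c cL xc; have pL := perm_to_rem cL.
  have lc : loops t (c :: rem c L) by rewrite -(loops_perm _ pL).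
  have [|c' [R [lR pR]]] := hw _ (loops_flip mt lc).
    by rewrite /= mem_cat mem_rev -[x]barK map_f.
  exists c', R; split=> //; apply: perm_trans pR.
  by rewrite (permPl (perm_map size pL)) /= size_rev size_map.
case/flattenP: (xL) => c cL xc; have pL := perm_to_rem cL.
have lc : loops t (c :: rem c L) by rewrite -(loops_perm _ pL).
have [i c' e] := rot_to xc; exists c', (rem c L); split.
  by have := loops_rot i lc; rewrite e.
by rewrite (permPl (perm_map size pL)) /= -(size_rot i) e.
Qed.

(** * Loop surgery by a transposition *)

Lemma step_conj t a j z : z != bar a -> z != bar j ->
  step (t ^ tperm a j)%g z = tperm a j (step t z).
Proof.
move=> za zj; have E : tperm a j (bar z) = bar z.
  by rewrite tpermD // eq_sym eq_bar.
by rewrite /step -{1}E permJ.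
Qed.

Section Conj.
Variables (t : {perm pt n}) (a j : pt n) (Y : seq (pt n)).
Hypotheses (uY : uniq (map fst Y)) (aY : a \in Y) (jY : j \in Y).

(** A list with distinct indices that contains [a] and [j] misses their bars. Hence, along [Y],
    conjugation changes an arrow only by exchanging the targets [a] and [j]. *)
Lemma step_conj_in z : z \in Y ->
  step (t ^ tperm a j)%g z = tperm a j (step t z).
Proof. by move=> zY; rewrite step_conj // (uniq_fst_bar uY). Qed.

(** Only targets change, so the starting point [x] may itself be [a] or [j]. *)
Lemma path_conj x p : {subset x :: p <= Y} -> a \notin p -> j \notin p ->
  path (frel (step t)) x p -> path (frel (step (t ^ tperm a j)%g)) x p.
Proof.
elim: p x => [|z p IH] x //= sY; rewrite !inE !negb_or.
case/andP=> az ap /andP[jz jp] /andP[/eqP xz pz]; apply/andP; split.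
  by rewrite step_conj_in ?sY ?inE ?eqxx // xz tpermD.
by apply: IH => // y yp; rewrite sY // inE yp orbT.
Qed.

Lemma cycle_conj c : {subset c <= Y} -> a \notin c -> j \notin c ->
  fcycle (step t) c -> fcycle (step (t ^ tperm a j)%g) c.
Proof.
case: c => [|x c] //= sY ac jc; apply: path_conj.
- by move=> y; rewrite inE mem_rcons => /predU1P[->|/sY//]; rewrite sY ?mem_head.
- by rewrite mem_rcons.
- by rewrite mem_rcons.
Qed.

Lemma all_conj R : {subset flatten R <= Y} -> a \notin flatten R ->
  j \notin flatten R -> all (fcycle (step t)) R ->
  all (fcycle (step (t ^ tperm a j)%g)) R.
Proof.
move=> sR aR jR /allP pR; apply/allP=> c cR.
have sc : {subset c <= flatten R} by move=> z zc; apply/flattenP; exists c.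
apply: cycle_conj (pR c cR) => [z /sc/sR //||].
  by apply: contra aR => /sc.
by apply: contra jR => /sc.
Qed.
End Conj.

Lemma uniq_split a A j B F : uniq (a :: A ++ j :: B ++ F) ->
  [/\ [/\ a \notin A, a \notin B & a \notin F],
      [/\ j \notin A, j \notin B & j \notin F] & a != j].
Proof.
rewrite /= cat_uniq /= !(mem_cat, inE) !negb_or.
case/and5P=> /and4P[-> -> -> ->] _ /andP[-> _] /andP[-> ->] _.
by [].
Qed.

Local Ltac submem :=
  let z := fresh "z" in move=> z; rewrite !(inE, mem_cat);
  do ?[case/orP]; move=> ->; rewrite ?orbT.

Local Ltac memlast :=
  match goal with |- is_true (last ?x ?s \in _) =>
    have := mem_last x s; rewrite !(inE, mem_cat); case/orP=> ->; rewrite ?orbT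
  end.

(** The arrows entering [j] and [a] exchange their targets, so each of the two segments closes up on
    itself. *)
Lemma loops_split t a A j B R : loops t ((a :: A ++ j :: B) :: R) ->
  loops (t ^ tperm a j)%g ((a :: A) :: (j :: B) :: R).
Proof.
move=> lL; have uL := loops_uniq lL; have := map_uniq uL.
rewrite /= -catA => /uniq_split[[aA aB aR] [jA jB jR] aj].
have [aL jL]: a \in flatten ((a :: A ++ j :: B) :: R) /\
              j \in flatten ((a :: A ++ j :: B) :: R).
  by rewrite !(inE, mem_cat) !eqxx !orbT.
have pconj := path_conj uL aL jL.
have aconj := all_conj uL aL jL.
move: lL; case/and3P; rewrite /= inE /= => N0 /andP[pc RR] pe; apply/and3P; split.
- by rewrite !inE.
- move: pc; rewrite rcons_cat cat_path /= => /and3P[pA /eqP lA].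
  rewrite rcons_path => /andP[pB /eqP lB]; rewrite /= !rcons_path /=.
  rewrite !pconj //= ?aconj //; try by submem.
  by rewrite !(step_conj_in _ uL aL jL) ?lA ?lB ?tpermL ?tpermR ?eqxx //; memlast.
- by move: pe; rewrite /= -!catA.
Qed.

Lemma loops_merge t a A j B R : loops t ((a :: A) :: (j :: B) :: R) ->
  loops (t ^ tperm a j)%g ((a :: A ++ j :: B) :: R).
Proof.
move=> lL; have uL := loops_uniq lL; have := map_uniq uL.
rewrite /= => /uniq_split[[aA aB aR] [jA jB jR] aj].
have [aL jL]: a \in flatten ((a :: A) :: (j :: B) :: R) /\
              j \in flatten ((a :: A) :: (j :: B) :: R).
  by rewrite !(inE, mem_cat) !eqxx !orbT.
have pconj := path_conj uL aL jL.
have aconj := all_conj uL aL jL.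
move: lL; case/and3P; rewrite /= !inE /= => N0 /and3P[pA pB RR] pe.
apply/and3P; split.
- by rewrite inE.
- move: pA pB; rewrite !rcons_path => /andP[pA /eqP lA] /andP[pB /eqP lB].
  rewrite /= rcons_path cat_path last_cat /=.
  rewrite !pconj //= ?aconj //; try by submem.
  by rewrite !(step_conj_in _ uL aL jL) ?lA ?lB ?tpermL ?tpermR ?eqxx //; memlast.
- by move: pe; rewrite /= -!catA.
Qed.

(* Here the two dashed edges are reconnected so that the segment following y
   is traversed backwards: the loop keeps its length. *)
Lemma loops_turn t a A y B R : matching t -> loops t ((a :: A ++ y :: B) :: R) ->
  loops (t ^ tperm a (bar y))%g ((a :: A ++ y :: rev (map (@bar n) B)) :: R).
Proof.
move=> mt lL; have uL := loops_uniq lL.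
set D := rev _; pose j := bar y.
have eD : map fst D = rev (map fst B) by rewrite map_rev -map_comp.
(* Here [y] and [B] give way to [bar y] and the reversed segment, so that both transposed points lie
   in a list with distinct indices. *)
have uY : uniq (map fst (a :: A ++ j :: D ++ flatten R)).
  move: uL; rewrite /= !map_cat /= map_cat -catA eD.
  set B' := map _ B; set A' := map _ A; set R' := map _ _; set y' := y.1.
  have P : perm_eq (A' ++ y' :: B' ++ R') (A' ++ y' :: rev B' ++ R').
    by rewrite perm_cat2l perm_cons perm_cat2r perm_sym perm_rev.
  by rewrite (perm_mem P) (perm_uniq P).
have [aY jY]: a \in a :: A ++ j :: D ++ flatten R /\
              j \in a :: A ++ j :: D ++ flatten R.
  by rewrite !(inE, mem_cat) !eqxx !orbT.
have /uniq_split[[aA aD aR] [jA jD jR] aj] := map_uniq uY.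
have ya : y != a.
  by apply: contraTneq uL => <-; rewrite /= !map_cat !mem_cat inE eqxx orbT.
have pconj := path_conj uY aY jY.
have aconj := all_conj uY aY jY.
move: lL; case/and3P; rewrite /= inE /= => N0 /andP[pc RR] pe; apply/and3P; split.
- by rewrite inE.
- rewrite /= aconj // ?andbT; last by submem.
  move: pc; rewrite !rcons_cat !cat_path /= => /and3P[pA /eqP lA pB].
  rewrite pconj //; try by submem.
  rewrite (step_conj_in _ uY aY jY) ?lA; last by memlast.
  rewrite tpermD // ?eqxx /=; [|by rewrite eq_sym|exact: bar_neq].
  have := path_step_rev mt pB; rewrite -/D -/j => pD.
  (* The point [y] lies outside this list: its arrow leaves through [bar y], which the transposition
     exchanges with [a]. *)
  have sy : step (t ^ tperm a j)%g y = tperm a j (step t (bar a)).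
    by rewrite /step barK -permJ tpermL.
  (* If the reversed segment is empty, [y] points straight to [a]; otherwise it points to the head
     [d], and the last point of the segment returns to [a]. *)
  case: D aD jD eD uY aY jY pD pconj {aR jR aj ya aconj} => [|d D].
    by move=> _ _ _ _ _ _ /= /andP[/eqP da _] _; rewrite sy da tpermR eqxx.
  rewrite !inE !negb_or => /andP[ad aD] /andP[jd jD] _ uY aY jY /=.
  case/andP=> /eqP da; rewrite !rcons_path => /andP[pD /eqP lD] pconj.
  rewrite sy da tpermD ?eqxx //= pconj //=; last by submem.
  by rewrite (step_conj_in _ uY aY jY) ?lD ?tpermR //; memlast.
- apply: perm_trans pe; rewrite /= !map_cat /= perm_cons -!catA perm_cat2l.
  by rewrite perm_cons perm_cat2r eD perm_rev.
Qed.
End Loops.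

(** * Coset-types and double cosets *)

Section CosetType.
Variable n : nat.
Implicit Types (s t : {perm pt n}) (x y z : pt n) (c : seq (pt n)).
Implicit Types (L : seq (seq (pt n))).

Definition mt s := (barp n ^ s)%g.

Lemma mt_matching s : matching (mt s).
Proof. exact/conj_matching/barp_matching. Qed.

Lemma coset_edgeE s x y : coset_edge s x y = (y == bar x) || (y == mt s x).
Proof.
rewrite /coset_edge; congr (_ || _); apply/existsP/eqP.
  by case=> z /andP[/eqP-> /eqP->]; rewrite /mt permJ barpE.
move=> ->; exists ((s^-1)%g x); rewrite permKV eqxx /=.
by rewrite -{1}(permKV s x) /mt permJ barpE.
Qed.

(** A loop lists one end of each solid edge; both ends are restored here, which gives the vertex set
    of a component. *)
Definition block c : {set pt n} := [set x | x.1 \in map fst c].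

Lemma card_block c : uniq (map fst c) -> #|block c| = (size c).*2.
Proof.
move=> uc; have -> : block c = setX [set i in map fst c] [set: bool].
  by apply/setP=> -[i b]; rewrite !inE andbT.
rewrite cardsX cardsT card_bool muln2 cardsE.
by rewrite (card_uniqP uc) size_map.
Qed.

Lemma loops_uniq_mem t L c : loops t L -> c \in L -> uniq (map fst c).
Proof.
move=> lL /perm_to_rem pL; rewrite (loops_perm _ pL) in lL.
by have := loops_uniq lL; rewrite map_cat cat_uniq => /andP[].
Qed.

(** The matching sends a point of the loop to the bar of its predecessor, and the bar of a point to
    its successor. *)
Lemma block_matching t c x : matching t -> fcycle (step t) c ->
  x \in block c -> t x \in block c.
Proof.
move=> [tK _] pc; rewrite !inE => /mapP[x0 xc /fst_eq/orP[]/eqP->].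
  have /eqP <- := prev_cycle pc xc; rewrite /step tK /=.
  by apply: map_f; rewrite mem_prev.
by have /eqP e := next_cycle pc xc; rewrite -/(step _ _) e map_f ?mem_next.
Qed.

Lemma block_closed s L c x y : loops (mt s) L -> c \in L ->
  connect (coset_edge s) x y -> (x \in block c) = (y \in block c).
Proof.
move=> /and3P[_ /allP pL _] cL; have pc := pL c cL.
have [tK _] := mt_matching s.
have clo z := @block_matching _ c z (mt_matching s) pc.
apply: closed_connect => {x y} x y; rewrite coset_edgeE => /orP[]/eqP->.
  by rewrite !inE.
by apply/idP/idP => [/clo //|/clo]; rewrite tK.
Qed.

Lemma connect_block s L c x y : loops (mt s) L -> c \in L -> x \in block c ->
  connect (coset_edge s) x y = (y \in block c).
Proof.
move=> lL cL xc; apply/idP/idP => [xy|].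
  by rewrite -(block_closed lL cL xy).
have bc z : connect (coset_edge s) z (bar z).
  by apply: connect1; rewrite coset_edgeE eqxx.
have pc : fcycle (step (mt s)) c by case/and3P: lL => _ /allP/(_ c cL).
have cc : {in c &, forall x y, connect (coset_edge s) x y}.
  move=> x0 y0 x0c y0c; have := connect_cycle pc x0c y0c.
  apply: connect_sub => {x0 y0 x0c y0c} x0 y0 /eqP <-.
  apply: connect_trans (bc x0) (connect1 _).
  by rewrite coset_edgeE /step eqxx orbT.
rewrite inE => /mapP[y0 y0c /fst_eq ey]; move: xc.
rewrite inE => /mapP[x0 x0c /fst_eq ex].
apply: (@connect_trans _ _ x0); first by case/orP: ex => /eqP-> //; rewrite -{2}[x0]barK.
apply: (connect_trans (cc _ _ x0c y0c)).
by case/orP: ey => /eqP->.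
Qed.

Lemma loops_coset_type s L : loops (mt s) L ->
  coset_type s = sort geq (map size L).
Proof.
move=> lL; have uL := loops_uniq lL; have N0 : [::] \notin L by case/and3P: lL.
apply/perm_sortP.
- by move=> i j; apply: leq_total.
- by move=> i j k; rewrite /geq /= => h1 h2; apply: leq_trans h2 h1.
- by move=> i j; rewrite andbC -eqn_leq => /eqP.
(* Each length is written as half the size of a block; it remains to see that the blocks are the
   components, without repetition. *)
have -> : map size L = [seq #|C|./2 | C : {set pt n} <- map block L].
  rewrite -map_comp; apply/eq_in_map => c cL; rewrite /= card_block ?doubleK //.
  exact: loops_uniq_mem lL cL.
apply: perm_map; apply: uniq_perm; first exact: enum_uniq.
  (* Blocks of different loops differ, being nonempty with disjoint sets of indices. *)
  elim: L uL N0 {lL} => //= c L IH; rewrite inE negb_or map_cat cat_uniq.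
  case/and3P=> _ /hasPn dc uL /andP[c0 /IH-> //]; rewrite andbT.
  case: c c0 dc => // x c _ dc; apply/mapP=> -[c' cL' e].
  have : x \in block c' by rewrite -e inE mem_head.
  rewrite inE => /mapP[y yc xy].
  have /dc /negP[] : y.1 \in map fst (flatten L).
    by apply: map_f; apply/flattenP; exists c'.
  by rewrite -xy mem_head.
move=> B; rewrite mem_enum; apply/imsetP/mapP.
  case=> x _ ->; have : x.1 \in map fst (flatten L).
    by case/and3P: lL => _ _ /perm_mem->; rewrite mem_enum.
  case/mapP=> y /flattenP[c cL yc] xy; exists c => //; apply/setP => z.
  rewrite [LHS]inE in_setT /= (connect_block _ lL cL) // inE xy; exact: map_f.
case=> c cL ->; case: c cL N0 => [->//|x c cL _]; exists x => //.
apply/setP => z; rewrite [RHS]inE in_setT /= (connect_block _ lL cL) //.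
by rewrite inE mem_head.
Qed.

(** Removing one step at each end of such an equality shortens it by two, down to a fixed point of
    [bar] or of [t]. Thus no orbit of [step t] meets both ends of a solid edge. *)
Lemma iter_step_neq t k x : matching t -> iter k (step t) x != bar x.
Proof.
move=> [tK tN]; elim/ltn_ind: k x => -[|[|k]] IH x.
- by rewrite eq_sym bar_neq.
- exact: tN.
apply: contra (IH k _ (step t x)) => [/eqP e|]; last exact: leqnSn.
apply/eqP; move: e; rewrite iterS iterSr {1}/step => /(congr1 t).
by rewrite tK => e; rewrite -[LHS](@barK n) e.
Qed.

Lemma step_inj t : injective (step t).
Proof. by move=> x y /perm_inj/(inv_inj (@barK n)). Qed.

Lemma uniq_orbit_fst t x : matching t -> uniq (map fst (fingraph.orbit (step t) x)).
Proof.
move=> mt'; rewrite map_inj_in_uniq ?fingraph.orbit_uniq // => y z.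
rewrite -!fconnect_orbit => xy xz /fst_eq/orP[/eqP //|/eqP yz].
have : fconnect (step t) z y.
  by rewrite (connect_trans _ xy) // fconnect_sym //; apply: step_inj.
rewrite yz => /iter_findex e; have := iter_step_neq (findex (step t) z (bar z)) z mt'.
by rewrite e eqxx.
Qed.

(* One orbit out of each pair of bar-conjugate orbits of [step t] is peeled off
   at a time. *)
Lemma loops_exist t : matching t -> exists L, loops t L.
Proof.
move=> mt'; have [tK tN] := mt'; rewrite /loops.
(* The claim is generalized to index sets closed under [t], a property that survives the removal of
   an orbit. *)
suff H k (A : {set 'I_n}) : (#|A| <= k)%N -> (forall x, x.1 \in A -> (t x).1 \in A) ->
    exists L, [&& [::] \notin L, all (fcycle (step t)) L
                & perm_eq (map fst (flatten L)) (enum A)].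
  have [|L HL] := H _ [set: 'I_n] (leqnn _) _; first by move=> x _; rewrite inE.
  by exists L; rewrite enum_setT in HL; rewrite enumT.
elim: k A => [|k IH] A leA cA.
  by move: leA; rewrite leqn0 cards_eq0 => /eqP->; exists [::]; rewrite enum_set0.
have [->|[i iA]] := set_0Vmem A; first by exists [::]; rewrite enum_set0.
pose x : pt n := (i, false); pose c := fingraph.orbit (step t) x.
have pc : fcycle (step t) c := cycle_orbit (@step_inj t) x.
have uc : uniq (map fst c) := uniq_orbit_fst x mt'.
have xc : x \in c by rewrite -fconnect_orbit connect0.
have cA1 y : y \in c -> y.1 \in A.
  rewrite -fconnect_orbit => /iter_findex <-; elim: (findex _ _ _) => //= m.
  by move=> IHm; apply: cA.
have [||L /and3P[N0 aL pL]] := IH (A :\: [set j in map fst c]).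
- rewrite -ltnS; apply: leq_trans leA; apply: proper_card.
  apply/properP; split; first exact: subsetDl.
  by exists i => //; rewrite !inE (map_f fst xc).
- move=> y; rewrite !inE => /andP[yc yA]; rewrite cA // andbT.
  apply: contra yc => yc; have := @block_matching t c (t y) mt' pc.
  by rewrite !inE tK; apply.
exists (c :: L); rewrite /= pc aL inE negb_or N0 andbT /=; apply/andP; split.
  by rewrite eq_sym; case: (c) xc.
have uL : uniq (map fst (flatten L)) by rewrite (perm_uniq pL) enum_uniq.
rewrite map_cat; apply: uniq_perm; rewrite ?enum_uniq //.
  rewrite cat_uniq uc uL andbT; apply/hasPn => j.
  by rewrite (perm_mem pL) mem_enum !inE => /andP[].
move=> j; rewrite mem_cat (perm_mem pL) !mem_enum !inE.
by case: (boolP (j \in map fst c)) => //= /mapP[y yc ->]; rewrite cA1.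
Qed.

(** The bar-equivariant map taking the entries of [Y] to those of [Y'] in order. Since [pt n] may be
    empty, the default of [nth] is built from [x]. *)
Definition relabel (Y Y' : seq (pt n)) (x : pt n) : pt n :=
  if x \in Y then nth (x.1, false) Y' (index x Y)
  else bar (nth (x.1, false) Y' (index (bar x) Y)).

Definition transversal_pts (Y : seq (pt n)) := perm_eq (map fst Y) (enum 'I_n).

Lemma transversal_bar Y x : transversal_pts Y -> (bar x \in Y) = (x \notin Y).
Proof.
move=> hY; have uY : uniq (map fst Y) by rewrite (perm_uniq hY) enum_uniq.
apply/idP/idP => [bY|].
  by apply/negP=> /(uniq_fst_bar uY bY); rewrite eqxx.
have : x.1 \in map fst Y by rewrite (perm_mem hY) mem_enum.
by case/mapP=> y yY /fst_eq/orP[]/eqP->; rewrite ?barK ?yY.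
Qed.

Lemma transversal_uniq Y : transversal_pts Y -> uniq Y.
Proof. by move=> hY; apply: (@map_uniq _ _ fst); rewrite (perm_uniq hY) enum_uniq. Qed.

Lemma transversal_size Y : transversal_pts Y -> size Y = n.
Proof. by move/perm_size; rewrite size_map size_enum_ord. Qed.

Section Relabel.
Variables Y Y' : seq (pt n).
Hypotheses (hY : transversal_pts Y) (hY' : transversal_pts Y').

Lemma relabel_in x : x \in Y -> relabel Y Y' x \in Y'.
Proof.
have sz : size Y' = size Y by rewrite !transversal_size.
by move=> xY; rewrite /relabel xY mem_nth // sz index_mem.
Qed.

Lemma relabel_bar x : relabel Y Y' (bar x) = bar (relabel Y Y' x).
Proof. by rewrite /relabel transversal_bar // !barK; case: (x \in Y); rewrite /= ?barK. Qed.

Lemma map_relabel : map (relabel Y Y') Y = Y'.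
Proof.
have uY := transversal_uniq hY.
have sz : size Y' = size Y by rewrite !transversal_size.
case E : Y sz => [|x0 Z] sz; first by rewrite (size0nil sz).
rewrite -E in sz *.
apply: (@eq_from_nth _ x0); rewrite ?size_map // => i iY.
rewrite (nth_map x0) // /relabel mem_nth // index_uniq //.
by apply: set_nth_default; rewrite sz.
Qed.
End Relabel.

Lemma relabelK Y Y' : transversal_pts Y -> transversal_pts Y' ->
  cancel (relabel Y Y') (relabel Y' Y).
Proof.
move=> hY hY' x; wlog xY : x / x \in Y => [hw|].
  have [/hw //|] := boolP (x \in Y); rewrite -transversal_bar // => /hw.
  by rewrite !relabel_bar // => /(inv_inj (@barK n)).
have uY' := transversal_uniq hY'.
have sz : size Y' = size Y by rewrite !transversal_size.
rewrite {1}/relabel relabel_in // /relabel xY index_uniq ?sz ?index_mem //.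
by rewrite nth_index.
Qed.

(** Relabelling the loops of [t] as those of [t'], position by position, commutes with [bar] and
    with the steps, hence carries [t] to [t']. *)
Lemma loops_conj t t' L L' : matching t -> matching t' ->
  loops t L -> loops t' L' -> map size L = map size L' ->
  exists u : {perm pt n}, (forall x, u (bar x) = bar (u x)) /\ t' = (t ^ u)%g.
Proof.
move=> mt1 mt2 lL lL' szL.
have hY : transversal_pts (flatten L) by case/and3P: lL.
have hY' : transversal_pts (flatten L') by case/and3P: lL'.
pose f := relabel (flatten L) (flatten L').
have f_inj : injective f by apply: can_inj (relabelK hY hY').
have mL : map (map f) L = L'.
  apply: eq_from_flatten_shape; first by rewrite -map_flatten map_relabel.
  rewrite /shape -map_comp -szL; apply: eq_map => c; exact: size_map.
have fs x : x \in flatten L -> f (step t x) = step t' (f x).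
  case/flattenP=> c cL xc; have uc : uniq c := map_uniq (loops_uniq_mem lL cL).
  have pc : fcycle (step t) c by case/and3P: lL => _ /allP/(_ c cL).
  have pc' : fcycle (step t') (map f c).
    by case/and3P: lL' => _ /allP H _; apply: H; rewrite -mL map_f.
  have /eqP-> := next_cycle pc xc.
  by have /eqP-> := next_cycle pc' (map_f f xc); rewrite next_map.
have fb x : f (bar x) = bar (f x) by apply: relabel_bar.
exists (perm f_inj); split=> [x|]; first by rewrite !permE fb.
have [tK _] := mt1; have [tK' _] := mt2.
apply/permP=> y; rewrite -[y](permKV (perm f_inj)); set x := (_ y).
rewrite permJ !permE; have fE z : bar z \in flatten L -> t' (f z) = f (t z).
  by move/fs; rewrite /step fb !barK.
have [/fE//|xY] := boolP (bar x \in flatten L).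
(* For [x] on the list, [t x] is the bar of its predecessor, so [fE] applies to [t x] in place of
   [x]. *)
rewrite -[RHS]tK' (fE (t x)) ?tK //.
rewrite transversal_bar // in xY; rewrite negbK in xY.
case/flattenP: xY => c cL xc; apply/flattenP; exists c => //.
have pc : fcycle (step t) c by case/and3P: lL => _ /allP/(_ c cL).
have /eqP <- := prev_cycle pc xc; rewrite /step tK barK.
by rewrite mem_prev.
Qed.

(** Sorting the loops by length aligns the two lists. The conclusion says that [s'] lies in the
    double coset of [s] modulo the hyperoctahedral group. *)
Lemma coset_type_conj s s' : coset_type s = coset_type s' ->
  exists u : {perm pt n}, (forall x, u (bar x) = bar (u x)) /\ mt s' = (mt s ^ u)%g.
Proof.
have [L lL] := loops_exist (mt_matching s).
have [L' lL'] := loops_exist (mt_matching s').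
rewrite (loops_coset_type lL) (loops_coset_type lL') !sort_map.
apply: loops_conj (mt_matching s) (mt_matching s') _ _.
  by rewrite (loops_perm _ (permEl (perm_sort _ L))).
by rewrite (loops_perm _ (permEl (perm_sort _ L'))).
Qed.
End CosetType.

(** * Symmetric functions of commuting elements *)

Section Symmetric.
Variables (R : pzRingType) (n : nat) (x : 'I_n -> R).

(** This is h_k in the first [r] variables, sorted by the largest index [i] of a monomial. The bound
    [i.+1] lets [x i] occur again, whereas the bound [i] in [elsym] excludes it. *)
Fixpoint hsym (r k : nat) : R :=
  if k is k'.+1 then \sum_(i < n | (i < r)%N) hsym i.+1 k' * x i else 1.

Fixpoint elsym (r k : nat) : R :=
  if k is k'.+1 then \sum_(i < n | (i < r)%N) elsym i k' * x i else 1.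

Lemma big_ord_ltS (V : nmodType) (i : 'I_n) (F : 'I_n -> V) :
  \sum_(j < n | (j < i.+1)%N) F j = \sum_(j < n | (j < i)%N) F j + F i.
Proof.
rewrite (bigD1 i) //= addrC; congr (_ + _); apply: eq_bigl => j.
by rewrite ltnS [RHS]ltn_neqAle andbC.
Qed.

Lemma hsymS (i : 'I_n) k : hsym i.+1 k.+1 = hsym i k.+1 + hsym i.+1 k * x i.
Proof. by rewrite /= big_ord_ltS. Qed.

Lemma elsymS (i : 'I_n) k : elsym i.+1 k.+1 = elsym i k.+1 + elsym i k * x i.
Proof. by rewrite /= big_ord_ltS. Qed.

(** Splitting off the last entry of a weakly increasing tuple gives the recursion of [hsym]: that
    entry becomes the bound for the others, and the order of the factors is kept. *)
Lemma complete_symE k : complete_sym k x = hsym n k.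
Proof.
have tr : transitive (relpre (val : 'I_n -> nat) leq).
  by move=> a b c; apply: leq_trans.
suff H r : (r <= n)%N -> \sum_(t : k.-tuple 'I_n | sorted (relpre val leq) t
      && all (fun i : 'I_n => i < r)%N t) \prod_(i <- t) x i = hsym r k.
  rewrite -H //; apply: eq_bigl => t; rewrite [X in _ && X](_ : _ = true) ?andbT //.
  by apply/allP => i _; apply: ltn_ord.
elim: k r => [|k IH] r rn.
  rewrite (big_pred1 [tuple]) ?big_nil // => t; rewrite (tuple0 t) /=.
  by apply/esym/eqP.
rewrite (reindex (fun p : k.-tuple 'I_n * 'I_n => [tuple of rcons p.1 p.2])); last first.
  exists (fun t : k.+1.-tuple 'I_n => 
    ([tuple of belast (thead t) (behead t)], last (thead t) (behead t))).
    case=> t i _; case: t => -[|a s] sz //=; congr (_, _).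
    - exact/val_inj.
    - by apply/val_inj; rewrite /= belast_rcons.
    - by rewrite last_rcons.
  by case/tupleP=> a s _; apply/val_inj; rewrite /= theadE -lastI.
have srt (t : k.-tuple 'I_n) i : sorted (relpre val leq) (rcons t i) &&
    all (fun i : 'I_n => i < r)%N (rcons t i) =
    (i < r)%N && (sorted (relpre val leq) t && all (fun j : 'I_n => j < i.+1)%N t).
  rewrite !sorted_pairwise // pairwise_rcons all_rcons.
  rewrite (eq_all (a1 := (relpre val leq)^~ i) (a2 := fun j : 'I_n => (j < i.+1)%N)) //.
  case ti: (all (fun j : 'I_n => (j < i.+1)%N) t); rewrite /= ?andbF ?andbT //.
  case ir: (i < r)%N; rewrite /= ?andbF // (_ : all _ t = true) ?andbT //.
  by apply/allP => j /(allP ti) ji; apply: leq_trans ji ir.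
rewrite (eq_bigl (fun p : k.-tuple 'I_n * 'I_n => xpredT p.1 && ((p.2 < r)%N &&
    (sorted (relpre val leq) p.1 && all (fun j : 'I_n => j < p.2.+1)%N p.1)))); last first.
  by move=> [t i] /=; apply: srt.
rewrite -(pair_big_dep xpredT (fun (t : k.-tuple 'I_n) (i : 'I_n) =>
  (i < r)%N && (sorted (relpre val leq) t && all (fun j : 'I_n => j < i.+1)%N t))
  (fun (t : k.-tuple 'I_n) i => \prod_(j <- rcons t i) x j)) /=.
rewrite (exchange_big_dep (fun i : 'I_n => (i < r)%N)) /=; last by move=> t i _ /andP[].
apply: eq_bigr => i ir; rewrite -IH // mulr_suml ir /=.
by apply: eq_bigr => t _; rewrite big_rcons.
Qed.

Hypothesis xC : forall i j, x i * x j = x j * x i.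

Lemma hsymC i r k : hsym r k * x i = x i * hsym r k.
Proof.
elim: k r => [|k IH] r /=; first by rewrite mulr1 mul1r.
rewrite mulr_suml mulr_sumr; apply: eq_bigr => j _.
by rewrite -mulrA xC mulrA IH mulrA.
Qed.

(** Induction on [r]: a further variable x multiplies the signed generating series of the e_j by 1 -
    x z and that of the h_j by its inverse, so the product of the two series stays 1. *)
Lemma elsym_hsym r k : (r <= n)%N ->
  \sum_(j < k.+2) (-1) ^+ j * (elsym r j * hsym r (k.+1 - j)) = 0.
Proof.
elim: r => [_|r IH rn].
  rewrite big_ord_recl big1 /= => [|j _].
    by rewrite big_pred0 // mulr0 mulr0 addr0.
  by rewrite big_pred0 // mul0r mulr0.
pose i := Ordinal rn; rewrite -[RHS](IH (ltnW rn)).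
(* Commutativity puts [x i] on the left, next to the factor coming from [elsym]. *)
have hS m : hsym r.+1 m.+1 = hsym r m.+1 + x i * hsym r.+1 m.
  by rewrite -hsymC -(hsymS i).
have eS j : (-1) ^+ j.+1 * (elsym r.+1 j.+1 * hsym r.+1 (k.+1 - j.+1)) =
    (-1) ^+ j.+1 * (elsym r j.+1 * hsym r.+1 (k.+1 - j.+1)) -
    (-1) ^+ j * (elsym r j * (x i * hsym r.+1 (k - j))).
  rewrite subSS (elsymS i) mulrDl mulrDr -/elsym; congr (_ + _).
  by rewrite exprS mulN1r mulNr -[elsym i j]/(elsym r j) !mulrA.
rewrite big_ord_recl; under eq_bigr => j _ do rewrite lift0 eS.
rewrite big_split /= addrA.
rewrite [X in X + _](_ : _ =
  \sum_(j < k.+2) (-1) ^+ j * (elsym r j * hsym r.+1 (k.+1 - j))); last first.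
  by rewrite [RHS]big_ord_recl; congr (_ + _); apply: eq_bigr => j _; rewrite lift0.
rewrite big_ord_recr [RHS]big_ord_recr /= subnn addrAC -big_split /=.
congr (_ + _); apply: eq_bigr => j _; rewrite -mulrBr -mulrBr; congr (_ * (_ * _)).
by rewrite subSn ?hS ?addrK // -ltnS.
Qed.
End Symmetric.

(** * Coefficients in the group algebra *)

Section GroupAlgebra.
Variable n : nat.
Implicit Types (A B : galg n) (s u : {perm pt n}).
Let G := [set: {perm pt n}]%G.

(** The regular representation sends [s] to right translation by [s], so the row indexed by the
    identity lists the coefficients. *)
Definition gcoef A s : rat := A (gring_index G 1%g) (gring_index G s).

Lemma gcoefZ a A s : gcoef (a *: A) s = a * gcoef A s.
Proof. by rewrite /gcoef mxE. Qed.

Lemma gcoef_sum I (r : seq I) (P : pred I) (F : I -> galg n) s :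
  gcoef (\sum_(i <- r | P i) F i) s = \sum_(i <- r | P i) gcoef (F i) s.
Proof. by rewrite /gcoef summxE. Qed.

Lemma perm_eltM s u : perm_elt (s * u)%g = perm_elt s * perm_elt u.
Proof. by rewrite /perm_elt repr_mxM ?inE. Qed.

Lemma gcoefM A s u : gcoef (A * perm_elt u) s = gcoef A (s * u^-1)%g.
Proof.
rewrite /gcoef mxE (bigD1 (gring_index G (s * u^-1)%g)) //= !mxE.
rewrite gring_indexK ?inE // mulgKV !eqxx mulr1 big1 ?addr0 // => i ne.
rewrite !mxE eqxx /= (_ : _ == _ = false) ?mulr0 //; apply: contraNF ne => /eqP e.
apply/eqP; rewrite -[i](gring_valK (G := G)); congr (gring_index G _).
by rewrite -[s](gring_indexK (G := G)) ?inE // e gring_indexK ?inE // mulgK.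
Qed.

Lemma gcoef_perm_elt s u : gcoef (perm_elt s) u = (s == u)%:R.
Proof.
rewrite /gcoef mxE gring_indexK ?inE // mul1g mxE eqxx /=.
by rewrite (can_in_eq (gring_indexK (G := G))) ?inE // eq_sym.
Qed.

Lemma gcoef_gset (S : {set {perm pt n}}) s : gcoef (gset_mx rat G S) s = (s \in S)%:R.
Proof.
rewrite gcoef_sum; under eq_bigr do rewrite -/(perm_elt _) gcoef_perm_elt.
have [sS|sS] := boolP (s \in S).
  by rewrite (bigD1 s) //= eqxx big1 ?addr0 // => u /andP[_ /negPf->].
by rewrite big1 // => u uS; case: eqP uS sS => // -> ->.
Qed.

(** Membership in the group algebra: [A] is recovered from its row at the identity. As [galg n]
    consists of all matrices, this condition is what allows equality to be checked on
    coefficients. *)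
Definition ingr A := gring_op (regular_repr rat G) A = A.

Lemma ingr_perm_elt s : ingr (perm_elt s).
Proof. by apply: gring_opG; rewrite inE. Qed.

Lemma ingrZ a A : ingr A -> ingr (a *: A).
Proof. by rewrite /ingr linearZ /= => ->. Qed.

Lemma ingr_sum I (r : seq I) (P : pred I) (F : I -> galg n) :
  (forall i, P i -> ingr (F i)) -> ingr (\sum_(i <- r | P i) F i).
Proof. by move=> H; rewrite /ingr linear_sum /=; apply: eq_bigr. Qed.

Lemma ingrM A s : ingr A -> ingr (A * perm_elt s).
Proof.
move=> iA; rewrite /ingr gring_opE gring_row_mul gring_mxJ ?inE //.
by rewrite -gring_opE iA.
Qed.

Lemma gcoef_inj A B : ingr A -> ingr B -> gcoef A =1 gcoef B -> A = B.
Proof.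
move=> iA iB AB; rewrite -iA -iB !gring_opE; congr (gring_mx _ _); apply/rowP => j.
by rewrite !mxE -(gring_valK j); apply: AB.
Qed.

(** For i < j, each transposition in J_i permutes the points below j and fixes j, so conjugation by
    it permutes the terms of J_j. *)
Lemma jmC (i j : 'I_n) : jm i * jm j = jm j * jm i.
Proof.
wlog ij : i j / (i < j)%N => [hw|].
  by case: (ltngtP i j) => [/hw//|/hw//|/val_inj->].
rewrite mulr_suml mulr_sumr; apply: eq_bigr => x xi.
rewrite mulr_suml mulr_sumr.
pose t := tperm x (i, false); have tl y : ((t y).1 < j)%N = (y.1 < j)%N.
  by rewrite /t; case: tpermP => [->|->|//] /=; rewrite ij (ltn_trans xi).
rewrite (reindex_inj (@perm_inj _ t)) /=; apply: eq_big => [y|y yj]; first exact: tl.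
rewrite -!perm_eltM -/t; congr perm_elt.
rewrite [RHS]conjgC tpermJ [t (j, false)]tpermD //.
  by apply: contraTneq xi => ->; rewrite /= -leqNgt ltnW.
by apply: contraTneq ij => -[->]; rewrite ltnn.
Qed.
End GroupAlgebra.

(** * Coefficients of p_n h_k(J) and p_n e_k(J) as functions of the matching *)

Section Coefficients.
Variable n : nat.
Implicit Types (t u s : {perm pt n}) (x y : pt n) (r k : nat).

(* The coefficients of p_n h_k(J_1, ..., J_r) and p_n e_k(J_1, ..., J_r) at
   sigma, as functions of the matching sigma^-1 bar sigma. *)
Fixpoint hcoef r k t : rat :=
  if k is k'.+1 then
    \sum_(i < n | (i < r)%N) \sum_(x : pt n | (x.1 < i)%N)
      hcoef i.+1 k' (t ^ tperm x (i, false))%g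
  else (t == barp n)%:R.

Fixpoint ecoef r k t : rat :=
  if k is k'.+1 then
    \sum_(i < n | (i < r)%N) \sum_(x : pt n | (x.1 < i)%N)
      ecoef i k' (t ^ tperm x (i, false))%g
  else (t == barp n)%:R.

Lemma hcoefS (i : 'I_n) k t : hcoef i.+1 k.+1 t = hcoef i k.+1 t +
  \sum_(x : pt n | (x.1 < i)%N) hcoef i.+1 k (t ^ tperm x (i, false))%g.
Proof. by rewrite /= big_ord_ltS. Qed.

Lemma ecoefS (i : 'I_n) k t : ecoef i.+1 k.+1 t = ecoef i k.+1 t +
  \sum_(x : pt n | (x.1 < i)%N) ecoef i k (t ^ tperm x (i, false))%g.
Proof. by rewrite /= big_ord_ltS. Qed.

Lemma mtM s u : mt (s * u)%g = (mt s ^ u)%g.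
Proof. by rewrite /mt conjgM. Qed.

Lemma hyperoct_mt s : (s \in hyperoct n) = (mt s == barp n).
Proof.
rewrite inE; apply/forallP/eqP => [sb|e x].
  apply/permP=> x; rewrite -[x](permKV s) /mt permJ !barpE.
  by rewrite (eqP (sb _)).
by rewrite -!barpE -{1}e /mt permJ.
Qed.

Lemma ingr_p_elt : ingr (p_elt n).
Proof. by apply: ingr_sum => s _; apply: ingr_perm_elt. Qed.

Lemma gcoef_p_elt s : gcoef (p_elt n) s = (mt s == barp n)%:R.
Proof. by rewrite gcoef_gset hyperoct_mt. Qed.

Lemma ingrM_jm (A : galg n) i : ingr A -> ingr (A * jm i).
Proof. by move=> iA; rewrite mulr_sumr; apply: ingr_sum => x _; apply: ingrM. Qed.

Lemma gcoefM_jm (A : galg n) i s : gcoef (A * jm i) s =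
  \sum_(x : pt n | (x.1 < i)%N) gcoef A (s * tperm x (i, false))%g.
Proof.
rewrite mulr_sumr gcoef_sum; apply: eq_bigr => x _.
by rewrite gcoefM tpermV.
Qed.

Lemma ingr_hsym r k : ingr (p_elt n * hsym (@jm n) r k).
Proof.
elim: k r => [|k IH] r /=; first by rewrite mulr1; apply: ingr_p_elt.
rewrite mulr_sumr; apply: ingr_sum => i _; rewrite mulrA; exact: ingrM_jm.
Qed.

Lemma ingr_elsym r k : ingr (p_elt n * elsym (@jm n) r k).
Proof.
elim: k r => [|k IH] r /=; first by rewrite mulr1; apply: ingr_p_elt.
rewrite mulr_sumr; apply: ingr_sum => i _; rewrite mulrA; exact: ingrM_jm.
Qed.

(** Right multiplication of sigma by a transposition conjugates its matching, so each factor J_i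
    yields one level of the recursion of [hcoef]. *)
Lemma gcoef_hsym r k s : gcoef (p_elt n * hsym (@jm n) r k) s = hcoef r k (mt s).
Proof.
elim: k r s => [|k IH] r s /=; first by rewrite mulr1 gcoef_p_elt.
rewrite mulr_sumr gcoef_sum; apply: eq_bigr => i _; rewrite mulrA gcoefM_jm.
by apply: eq_bigr => x _; rewrite IH mtM.
Qed.

Lemma gcoef_elsym r k s : gcoef (p_elt n * elsym (@jm n) r k) s = ecoef r k (mt s).
Proof.
elim: k r s => [|k IH] r s /=; first by rewrite mulr1 gcoef_p_elt.
rewrite mulr_sumr gcoef_sum; apply: eq_bigr => i _; rewrite mulrA gcoefM_jm.
by apply: eq_bigr => x _; rewrite IH mtM.
Qed.

Lemma size_flatten_loops t L : loops t L -> size (flatten L) = n.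
Proof. by case/and3P=> _ _ /perm_size; rewrite size_map size_enum_ord. Qed.

Lemma size_flattenP (T : eqType) (L : seq (seq T)) : [::] \notin L ->
  (size L <= size (flatten L))%N /\
  (size (flatten L) = size L -> all (fun c => size c == 1%N) L).
Proof.
elim: L => //= c L IH; rewrite inE negb_or size_cat => /andP[c0 /IH[le e1]].
have c1 : (0 < size c)%N by case: (c) c0.
split; first by rewrite -add1n leq_add.
move=> e; have [e2 e3] : size c = 1%N /\ size (flatten L) = size L.
  move: c1 le e; case: (size c) => // -[|a] _ le; first by case.
  by move=> /eqP; rewrite !addSn eqSS gtn_eqF // ltnS (leq_trans le) // leq_addl.
by rewrite e2 eqxx e1.
Qed.

Lemma loops_size t L : loops t L -> (size L <= n)%N.
Proof.
move=> lL; have [N0 _ _] := and3P lL; have [le _] := size_flattenP N0.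
by rewrite (size_flatten_loops lL) in le.
Qed.

(** The n indices form n loops only if all loops have length one, which means that [t] agrees with
    [bar]. *)
Lemma loops_size_barp t L : matching t -> loops t L ->
  (size L == n)%N = (t == barp n).
Proof.
move=> [tK _] lL; have sL := size_flatten_loops lL.
have [N0 /allP pL _] := and3P lL; apply/eqP/eqP => [sz|tb].
  have [_ /(_ _)/allP s1] := size_flattenP N0; rewrite sL sz in s1.
  have fx z : z \in flatten L -> t (bar z) = z.
    case/flattenP=> c cL; have := s1 erefl c cL; have := pL c cL.
    by case: c {cL} => [|y []] //=; rewrite andbT => /eqP yy _; rewrite inE => /eqP->.
  apply/permP=> x; rewrite barpE; case/orP: (loops_cover x lL) => /fx.
    by move=> {1}<-; rewrite tK.
  by rewrite barK.
rewrite -[RHS]sL; have : all (fun c => size c == 1%N) L.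
  apply/allP=> c cL; have := loops_uniq_mem lL cL; have := pL c cL.
  case: c cL => [|x [|y c]] //= cL; first by rewrite cL in N0.
  by rewrite /step tb barpE barK => /andP[/eqP->]; rewrite inE eqxx.
by elim: (L) => //= c L' IH /andP[/eqP c1 /IH->]; rewrite size_cat c1.
Qed.

(** The points of index at least [r] form loops of length one. The matching [barp] has this
    property, and conjugation by the transpositions of J_1, ..., J_r preserves it. *)
Definition fixed_from r t := [forall x : pt n, (r <= x.1)%N ==> (t x == bar x)].

Lemma fixed_fromS (i : 'I_n) t : matching t ->
  fixed_from i t = fixed_from i.+1 t && (t (bar (i, false)) == (i, false)).
Proof.
move=> [tK _]; apply/forallP/andP => [f|[/forallP f /eqP e] x].
  split; first by apply/forallP=> x; apply/implyP=> ix; apply: (implyP (f x)); apply: ltnW.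
  by have := f (bar (i, false)); rewrite leqnn barK.
apply/implyP; rewrite leq_eqVlt => /orP[|ix]; last exact: (implyP (f x)).
move=> /eqP/val_inj; rewrite -[i]/((i, false) : pt n).1 => /fst_eq; rewrite eq_sym.
case/orP=> [/eqP->|]; first by rewrite -{1}e tK.
by rewrite eq_sym eq_bar eq_sym => /eqP<-; rewrite e.
Qed.

Lemma tperm_gt x y (i : 'I_n) : (x.1 < i)%N -> (i < y.1)%N ->
  tperm x (i, false) y = y.
Proof.
move=> xi iy; rewrite tpermD //; last by apply: contraTneq iy => <-; rewrite ltnn.
by apply: contraTneq xi => ->; rewrite -leqNgt ltnW.
Qed.

Lemma tperm_bar x (i : 'I_n) : (x.1 < i)%N ->
  tperm x (i, false) (bar (i, false)) = bar (i, false).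
Proof.
move=> xi; rewrite tpermD //; last by rewrite eq_sym bar_neq.
by apply: contraTneq xi => ->; rewrite ltnn.
Qed.

Lemma conj_tperm_bar t x (i : 'I_n) : (x.1 < i)%N ->
  (t ^ tperm x (i, false))%g (bar (i, false)) = tperm x (i, false) (t (bar (i, false))).
Proof. by move=> xi; rewrite -{1}(tperm_bar xi) permJ. Qed.

Lemma fixed_from_conj t x (i : 'I_n) : (x.1 < i)%N ->
  fixed_from i.+1 (t ^ tperm x (i, false))%g = fixed_from i.+1 t.
Proof.
move=> xi; apply: eq_forallb => y; apply: implyb_id2l => iy.
have e : tperm x (i, false) (bar y) = bar y by apply: tperm_gt.
by rewrite -{1}(tperm_gt xi iy) permJ -{1}e (inj_eq perm_inj).
Qed.

(** Induction on [k] and [r]. In the sum added by the last variable, a term survives only if its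
    conjugation makes the last point [a] a loop of its own. None does if [a] is one already;
    otherwise only the partner of [bar a] does, and the number of loops grows by one. *)
Lemma ecoefE r k t L : (r <= n)%N -> matching t -> loops t L ->
  ecoef r k t = (fixed_from r t && (n - size L == k)%N)%:R.
Proof.
elim: k r t L => [|k IHk] r t L rn mt1 lL.
  rewrite /= -(loops_size_barp mt1 lL) subn_eq0; congr (nat_of_bool _)%:R.
  have sL := loops_size lL; apply/eqP/andP => [sz|[_ le]]; last first.
    by apply/eqP; rewrite eqn_leq sL.
  split; last by rewrite sz.
  have /eqP tb : t == barp n by rewrite -(loops_size_barp mt1 lL) sz.
  by apply/forallP=> x; rewrite tb barpE eqxx implybT.
elim: r t L rn mt1 lL => [|r IH] t L rn mt1 lL.
  rewrite /= big_pred0 //; case: (boolP (fixed_from 0 t)) => //= /forallP f.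
  have /eqP tb : t == barp n by apply/eqP/permP=> x; rewrite barpE (eqP (f x)).
  by move/eqP: tb; rewrite -(loops_size_barp mt1 lL) => /eqP->; rewrite subnn.
pose i := Ordinal rn; pose a : pt n := (i, false).
rewrite -[r.+1]/(i.+1) ecoefS (IH t L) ?(ltnW rn) //.
have cj x : exists L', loops (t ^ tperm x a)%g L'.
  exact/loops_exist/conj_matching.
have [tK tN] := mt1.
have [ta|ta] := eqVneq (t (bar a)) a.
  rewrite -[r]/(val i) (fixed_fromS i) // ta eqxx andbT big1 ?addr0 // => x xi.
  have [L' lL'] := cj x; rewrite (IHk i _ L') ?(ltnW rn) //; last exact: conj_matching.
  rewrite (fixed_fromS i) ?conj_tperm_bar //; last exact: conj_matching.
  rewrite ta tpermR; case: eqP => [e|_]; last by rewrite andbF.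
  by rewrite e ltnn in xi.
rewrite -[r]/(val i) (fixed_fromS i) // (negPf ta) andbF add0r.
set y := t (bar a) in ta *.
have ecj x L' : (x.1 < i)%N -> loops (t ^ tperm x a)%g L' ->
    ecoef i k (t ^ tperm x a)%g =
    ([&& fixed_from i.+1 t, tperm x a y == a & n - size L' == k]%N)%:R.
  move=> xi lL'; rewrite (IHk i _ L') ?(ltnW rn) //; last exact: conj_matching.
  rewrite (fixed_fromS i) ?conj_tperm_bar //; last exact: conj_matching.
  by rewrite fixed_from_conj // -andbA.
have zero x : (x.1 < i)%N -> ~~ fixed_from i.+1 t || (x != y) ->
    ecoef i k (t ^ tperm x a)%g = 0.
  move=> xi; have [L' lL'] := cj x; rewrite (ecj _ L') //.
  case: (fixed_from _ t) => //= xy.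
  by rewrite (tpermD xy) ?(negPf ta) // eq_sym.
have [f|f] := boolP (fixed_from i.+1 t); last first.
  by rewrite big1 // => x xi; apply: zero; rewrite ?f.
(* Points of index above [i] are matched with their bars, and [y] is neither [a] nor [bar a]. *)
have yi : (y.1 < i)%N.
  rewrite ltnNge leq_eqVlt; apply/norP; split.
    apply/negP=> /eqP/val_inj; rewrite -[i]/a.1 => /fst_eq; rewrite eq_sym.
    rewrite (negPf ta) /= => /eqP e; move: (tN (bar a)).
    by rewrite -/y e barK eqxx.
  apply/negP=> iy; have := implyP (forallP f y) iy.
  by rewrite /y tK (inj_eq (inv_inj (@barK n))) eq_sym (negPf ta).
rewrite (bigD1 y) //= big1 ?addr0 => [|x /andP[xi xy]]; last by rewrite zero ?xy ?orbT.
have [c [R [lR /perm_size]]] := loops_expose a mt1 lL; rewrite !size_map => ->.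
case: c lR => [|y' c] lR.
  by case/and3P: lR => _ /=; rewrite /step -/y (negPf ta).
have e : y' = y by case/and3P: lR => _ /= /andP[/andP[/eqP]].
(* As [y] directly follows [a], the split with empty [A] cuts off the loop [[:: a]]. *)
have lR' := loops_split (A := [::]) lR; rewrite e tpermC in lR'.
rewrite (ecj _ _ _ lR') // f tpermL eqxx /=; congr (nat_of_bool _)%:R.
(* The bound on the number of loops makes the truncated subtraction exact. *)
have /= le := loops_size lR'.
by rewrite -[LHS]eqSS -subSn // subSS.
Qed.

Lemma loops_conj_bar t u L : (forall x, u (bar x) = bar (u x)) ->
  loops t L -> loops (t ^ u)%g (map (map u) L).
Proof.
move=> ub lL; have uL := loops_uniq lL; have sL := size_flatten_loops lL.
have [N0 pL _] := and3P lL; apply/and3P; split.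
- by apply/mapP=> -[[|x c] cL] //; rewrite cL in N0.
- rewrite all_map; apply/allP=> c cL; have := allP pL c cL.
  rewrite /= => pc; rewrite cycle_map; apply: sub_cycle pc => x y /= /eqP <-.
  by rewrite /step -ub permJ.
- rewrite -map_flatten -map_comp.
  have uq : uniq (map (fst \o u) (flatten L)).
    rewrite map_inj_in_uniq ?(map_uniq uL) // => x y xL yL /fst_eq.
    rewrite -ub !(inj_eq perm_inj).
    by rewrite (negPf (uniq_fst_bar uL xL yL)) orbF => /eqP.
  apply: uniq_perm; rewrite ?enum_uniq //.
  have [||//] := uniq_min_size uq (s2 := enum 'I_n).
    by move=> x; rewrite mem_enum.
  by rewrite size_enum_ord size_map sL.
Qed.

(** For [r = n] the value depends only on the number of loops, which relabelling by [u]
    preserves. *)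
Lemma ecoef_conj k t u : matching t -> (forall x, u (bar x) = bar (u x)) ->
  ecoef n k (t ^ u)%g = ecoef n k t.
Proof.
move=> mt1 ub; have [L lL] := loops_exist mt1.
have fn v : fixed_from n v by apply/forallP=> x; rewrite leqNgt ltn_ord.
rewrite (ecoefE _ _ mt1 lL) // (ecoefE _ _ _ (loops_conj_bar ub lL)) //; last exact: conj_matching.
by rewrite !fn size_map.
Qed.

Lemma hyperoct_bar u : u \in hyperoct n -> forall x, u (bar x) = bar (u x).
Proof. by rewrite inE => /forallP ub x; rewrite (eqP (ub x)). Qed.
End Coefficients.

(** * Right invariance under the hyperoctahedral group *)

Section Invariance.
Variable n : nat.
Implicit Types (A X Y : galg n) (s u t : {perm pt n}).

Definition rinv A := forall u, u \in hyperoct n -> A * perm_elt u = A.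

Lemma hyperoct1 : 1%g \in hyperoct n.
Proof. by rewrite inE; apply/forallP=> x; rewrite !perm1. Qed.

Lemma hyperoctV u : u \in hyperoct n -> (u^-1)%g \in hyperoct n.
Proof.
move/hyperoct_bar=> ub; rewrite inE; apply/forallP=> x.
by rewrite -(inj_eq (@perm_inj _ u)) ub !permKV.
Qed.

Lemma rinv_elsym k : rinv (p_elt n * elsym (@jm n) n k).
Proof.
move=> u uH; apply: gcoef_inj; first exact/ingrM/ingr_elsym.
  exact: ingr_elsym.
move=> s; rewrite gcoefM !gcoef_elsym mtM ecoef_conj //; first exact: mt_matching.
exact/hyperoct_bar/hyperoctV.
Qed.

Let scaleAl a A B : a *: (A * B) = a *: A * B.
Proof. exact: scalemxAl. Qed.

Lemma rinvMp A : rinv A -> A * p_elt n = #|hyperoct n|%:R *: A.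
Proof.
move=> iA; rewrite mulr_sumr (eq_bigr (fun=> A)) => [|u]; last exact: iA.
by rewrite sumr_const scaler_nat.
Qed.

(** Invariance of p_n X gives |H_n| p_n X Y = (p_n X) (p_n Y), and the right factor absorbs [u]. *)
Lemma rinvM X Y : rinv (p_elt n * X) -> rinv (p_elt n * Y) ->
  rinv (p_elt n * (X * Y)).
Proof.
move=> iX iY u uH.
have c0 : #|hyperoct n|%:R != 0 :> rat.
  by rewrite Num.Theory.pnatr_eq0 -lt0n; apply/card_gt0P; exists 1%g; apply: hyperoct1.
apply: (scalerI c0); rewrite scaleAl.
have -> : #|hyperoct n|%:R *: (p_elt n * (X * Y)) = p_elt n * X * (p_elt n * Y).
  by rewrite mulrA scaleAl -(rinvMp iX) !mulrA.
by rewrite -[LHS]mulrA iY.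
Qed.

Lemma rinv_sum I (r : seq I) (P : pred I) (F : I -> galg n) :
  (forall i, P i -> rinv (F i)) -> rinv (\sum_(i <- r | P i) F i).
Proof.
by move=> H u uH; rewrite mulr_suml; apply: eq_bigr => i Pi; apply: H.
Qed.

(** Strong induction: the alternating relation expresses h_(k+1) through the products e_j h_(k+1-j)
    with j > 0, to which [rinvM] applies. *)
Lemma rinv_hsym k : rinv (p_elt n * hsym (@jm n) n k).
Proof.
elim/ltn_ind: k => -[_|k IH]; first exact: (rinv_elsym 0).
have := elsym_hsym (@jmC n) k (leqnn n).
rewrite big_ord_recl expr0 !mul1r subn0 => /eqP; rewrite addr_eq0 => /eqP->.
rewrite mulrN mulr_sumr => u uH; rewrite mulNr; congr (- _); move: u uH.
apply: rinv_sum => j _; rewrite lift0 subSS -signr_odd mulr_sign.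
have iM : rinv (p_elt n * (elsym (@jm n) n j.+1 * hsym (@jm n) n (k - j))).
  apply: rinvM; first exact: rinv_elsym.
  by apply: IH; rewrite ltnS leq_subr.
case: ifP => _ u uH; last exact: iM.
by rewrite mulrN mulNr iM.
Qed.

Lemma hcoef_coset_type k s s' : coset_type s = coset_type s' ->
  hcoef n k (mt s) = hcoef n k (mt s').
Proof.
move=> /coset_type_conj[u [ub ->]]; rewrite -mtM -!gcoef_hsym.
have uH : u \in hyperoct n by rewrite inE; apply/forallP=> x; rewrite ub.
rewrite -[in LHS](rinv_hsym k (hyperoctV uH)) gcoefM.
by rewrite invgK.
Qed.

Lemma coset_type_part s : is_part_of n (coset_type s).
Proof.
have [L lL] := loops_exist (mt_matching s); rewrite (loops_coset_type lL).
rewrite /is_part_of /is_part sort_sorted ?all_sort; last by move=> i j; apply: leq_total.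
have := size_flatten_loops lL; rewrite size_flatten /shape => sL.
rewrite (perm_sumn (permEl (perm_sort _ _))) sL eqxx andbT all_map.
by apply/allP=> -[|x c] //= H; case/and3P: lL; rewrite H.
Qed.

Lemma gcoef_coset_sum mu s : gcoef (coset_sum n mu) s = (coset_type s == mu)%:R.
Proof. by rewrite gcoef_gset inE. Qed.

Lemma size_part (s : seq nat) : all (fun p => 0 < p)%N s -> (size s <= sumn s)%N.
Proof. by elim: s => //= p s IH /andP[p0 /IH]; rewrite -add1n; apply: leq_add. Qed.

Lemma part_le (s : seq nat) p : p \in s -> (p <= sumn s)%N.
Proof.
elim: s => //= q s IH; rewrite inE => /predU1P[->|/IH]; first exact: leq_addr.
by move/leq_trans; apply; apply: leq_addl.
Qed.

Lemma gcoef_spec (b : seq nat -> rat) s :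
  gcoef (\sum_(mu : n.-bseq 'I_n.+1 | is_part_of n (map val mu))
           b (map val mu) *: coset_sum n (map val mu)) s = b (coset_type s).
Proof.
have [/andP[/andP[_ pos] /eqP sn]] := (coset_type_part s, tt).
(* A coset-type has at most n parts, each at most n, so it is encoded by one of the summation
   indices. *)
have sz : (size (map (@inord n) (coset_type s)) <= n)%N.
  by rewrite size_map -[leqRHS]sn size_part.
have e0 : map val (Bseq sz) = coset_type s.
  rewrite /= -map_comp map_id_in // => p /part_le; rewrite sn => le /=.
  by rewrite inordK.
rewrite gcoef_sum (bigD1 (Bseq sz)) ?e0 ?coset_type_part //=.
rewrite gcoefZ gcoef_coset_sum eqxx mulr1 big1 ?addr0 // => mu /andP[_ ne].
rewrite gcoefZ gcoef_coset_sum; case: eqP => [e|]; last by rewrite mulr0.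
case/negP: ne; apply/eqP/val_inj/(inj_map val_inj).
exact: etrans (esym e) (esym e0).
Qed.
End Invariance.

(** A suitable family [b] exists: it reads the coefficient at any permutation of the given
    coset-type, and the value is independent of the choice. Hence [h_coef] satisfies its
    specification, whose two sides are compared at [s]. *)
Lemma h_coefP n k (s : {perm pt n}) :
  h_coef k (coset_type s) = hcoef n k (mt s).
Proof.
pose b k mu := if [pick s : {perm pt (sumn mu)} | coset_type s == mu] is Some s
  then hcoef (sumn mu) k (mt s) else 0.
have ex : exists b, h_coef_spec b.
  exists b => {n k s} n k.
  rewrite complete_symE; apply: gcoef_inj; first exact: ingr_hsym.
    apply: ingr_sum => mu _; apply: ingrZ; apply: ingr_sum => s _.
    exact: ingr_perm_elt.
  move=> s; rewrite (gcoef_spec (b k)) gcoef_hsym /b.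
  (* The index [n] has to become [sumn mu] before the picked permutation can be compared with
     [s]. *)
  have /andP[_ /eqP] := coset_type_part s; move e: (coset_type s) => mu sn; case: n / sn s e => s e.
  case: pickP => [s' /eqP e'|/(_ s)]; last by rewrite e eqxx.
  by apply: hcoef_coset_type; rewrite e e'.
have := epsilon_spec (inhabits (fun _ _ => 0)) _ ex n k.
rewrite -/h_coef complete_symE => /(congr1 (fun A => gcoef A s)).
by rewrite gcoef_spec gcoef_hsym.
Qed.

Lemma conj_tpermE (T : finType) (s : {perm T}) (a b z : T) :
  (s ^ tperm a b)%g z = tperm a b (s (tperm a b z)).
Proof. by rewrite -{1}[z](tpermK a b) permJ. Qed.

(** * The recursion *)

Section Lift.
Variable n : nat.
Implicit Types (s : {perm pt n}) (x y : pt n) (c : seq (pt n)).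

Definition up x : pt n.+1 := (lift ord_max x.1, x.2).
Definition down (x : pt n.+1) : option (pt n) :=
  omap (fun j => (j, x.2)) (unlift ord_max x.1).
Local Notation top := ((ord_max, false) : pt n.+1).

Lemma upK : pcancel up down.
Proof. by case=> i b; rewrite /down /= liftK. Qed.

Lemma up_inj : injective up.
Proof. exact: pcan_inj upK. Qed.

Lemma up_bar x : up (bar x) = bar (up x).
Proof. by []. Qed.

Lemma val_up x : (up x).1 = x.1 :> nat.
Proof. exact: lift_max. Qed.

Lemma upP (x : pt n.+1) : x.1 = ord_max \/ exists y, x = up y.
Proof.
case: x => i b /=; case: (unliftP ord_max i) => [j ->|->]; last by left.
by right; exists (j, b).
Qed.

(** This gives the embedding of S_2n into S_(2n+2) that fixes the last point and its bar. *)
Definition ext s (x : pt n.+1) : pt n.+1 := oapp (fun y => up (s y)) x (down x).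

Lemma ext_up s y : ext s (up y) = up (s y).
Proof. by rewrite /ext upK. Qed.

Lemma ext_top s (x : pt n.+1) : x.1 = ord_max -> ext s x = x.
Proof. by rewrite /ext /down => ->; rewrite unlift_none. Qed.

Lemma extK s : cancel (ext s) (ext s^-1).
Proof.
move=> x; case: (upP x) => [xm|[y ->]]; first by rewrite !ext_top.
by rewrite !ext_up permK.
Qed.

Definition ext_perm s : {perm pt n.+1} := perm (can_inj (@extK s)).

Lemma ext_permV s (x : pt n.+1) : ((ext_perm s)^-1)%g x = ext s^-1 x.
Proof. by apply: (@perm_inj _ (ext_perm s)); rewrite permKV permE -{1}[s]invgK extK. Qed.

Lemma mt_ext_up s y : mt (ext_perm s) (up y) = up (mt s y).
Proof.
by rewrite /mt !conjgE !permM !barpE ext_permV ext_up permE -up_bar ext_up.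
Qed.

Lemma mt_ext_top s b : mt (ext_perm s) (ord_max, b) = bar (ord_max, b).
Proof. by rewrite /mt !conjgE !permM !barpE ext_permV ext_top // permE ext_top. Qed.

Lemma loops_ext s L : loops (mt s) L ->
  loops (mt (ext_perm s)) ([:: top] :: map (map up) L).
Proof.
case/and3P=> N0 pL hL; have stU x : step (mt (ext_perm s)) (up x) = up (step (mt s) x).
  by rewrite /step -up_bar mt_ext_up.
apply/and3P; split.
- by rewrite inE /=; apply/mapP=> -[[|x c] cL] //; rewrite cL in N0.
- rewrite /= /step mt_ext_top eqxx /= all_map; apply/allP=> c cL.
  rewrite /= cycle_map; apply: sub_cycle (allP pL c cL) => x y /= /eqP <-.
  by rewrite -/(step _ _) stU.
rewrite /= -map_flatten -map_comp.
have -> : map (fst \o up) (flatten L) = map (lift ord_max) (map fst (flatten L)).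
  by rewrite -map_comp.
apply: uniq_perm; rewrite ?enum_uniq //.
  rewrite /= (map_inj_uniq (@lift_inj _ _)) (perm_uniq hL) enum_uniq andbT.
  by apply/mapP=> -[j _ /eqP]; rewrite (negPf (neq_lift _ _)).
move=> i; rewrite mem_enum inE; case: (unliftP ord_max i) => [j ->|->]; last by rewrite eqxx.
by rewrite map_f ?orbT // (perm_mem hL) mem_enum.
Qed.

Lemma sum_up r (F : pt n.+1 -> rat) : (r <= n)%N ->
  \sum_(x : pt n.+1 | (x.1 < r)%N) F x = \sum_(y : pt n | (y.1 < r)%N) F (up y).
Proof.
move=> rn; rewrite (reindex_omap up down) => [|x xr].
  by apply: eq_bigl => y; rewrite val_up upK eqxx andbT.
case: (upP x) => [e|[y ->]]; last by rewrite upK.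
by rewrite e ltnNge rn in xr.
Qed.

Lemma sum_lift r (F : 'I_n.+1 -> rat) : (r <= n)%N ->
  \sum_(i < n.+1 | (i < r)%N) F i = \sum_(i < n | (i < r)%N) F (lift ord_max i).
Proof.
move=> rn; rewrite (reindex_omap (lift ord_max) (unlift ord_max)) => [|i ir].
  by apply: eq_bigl => j; rewrite lift_max liftK eqxx andbT.
case: unliftP => [j -> //|e]; by rewrite e ltnNge rn in ir.
Qed.

(** For [r <= n] the elements J_1, ..., J_r involve only points in the image of [up], so the
    recursion takes place inside S_2n. *)
Lemma hcoef_up r k (t : {perm pt n.+1}) (t' : {perm pt n}) : (r <= n)%N ->
  (forall x, t (up x) = up (t' x)) -> (forall b, t (ord_max, b) = bar (ord_max, b)) ->
  hcoef r k t = hcoef r k t'.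
Proof.
elim: k r t t' => [|k IH] r t t' rn tu tb /=.
  congr (nat_of_bool _)%:R; apply/eqP/eqP => /permP e; apply/permP=> x.
    by apply: up_inj; rewrite -tu e !barpE.
  rewrite barpE; case: (upP x) => [|[y ->]]; last by rewrite tu e barpE.
  by case: x => i b /= ->.
rewrite sum_lift //; apply: eq_bigr => i ir.
have ix : lift ord_max i = i :> nat by apply: lift_max.
rewrite ix sum_up ?(ltnW (ltn_ord i)) //; apply: eq_bigr => x xi.
have tpu y : tperm (up x) (lift ord_max i, false) (up y) = up (tperm x (i, false) y).
  by rewrite [RHS](inj_tperm _ _ _ (@up_inj)).
have tpt b : tperm (up x) (lift ord_max i, false) (ord_max, b) = (ord_max, b).
  by rewrite tpermD // xpair_eqE eq_sym (negPf (neq_lift _ _)).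
apply: IH => [|y|b]; first exact: leq_trans ir rn.
  by rewrite !conj_tpermE tpu tu tpu.
by rewrite conj_tpermE tpt tb /bar /= tpt.
Qed.
End Lift.

(** The transpositions of J_1, ..., J_r fix both points of index [i], and [barp] matches these two
    with each other. *)
Lemma hcoef_eq0 n r k (t : {perm pt n}) (i : 'I_n) : (r <= i)%N ->
  t (bar (i, false)) != (i, false) -> hcoef r k t = 0.
Proof.
elim: k r t => [|k IH] r t ri ti /=.
  by case: eqP => // e; rewrite e barpE barK eqxx in ti.
rewrite big1 // => j jr; rewrite big1 // => x xj; apply: IH.
  exact: leq_trans jr ri.
have ji : (j < i)%N := leq_trans jr ri.
rewrite conj_tpermE (@tperm_gt _ x (bar (i, false)) j) //.
by rewrite -{2}(@tperm_gt _ x (i, false) j) // (inj_eq perm_inj).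
Qed.

(** * Permutations with prescribed loop lengths *)

Lemma map_size_up n (L : seq (seq (pt n))) :
  map size (map (map (@up n)) L) = map size L.
Proof. by rewrite -map_comp; apply: eq_map => c /=; rewrite size_map. Qed.

Lemma loops_ext_merge n (s : {perm pt n}) y c R : loops (mt s) ((y :: c) :: R) ->
  loops (mt (ext_perm s * tperm (ord_max, false) (up y))%g)
    (((ord_max, false) :: up y :: map (@up n) c) :: map (map (@up n)) R).
Proof.
by move/loops_ext => /= lL; rewrite mtM; apply: (loops_merge (A := [::])).
Qed.

Lemma hcoef_loops n k (sg : {perm pt n}) L : loops (mt sg) L ->
  hcoef n k (mt sg) = h_coef k (sort geq (map size L)).
Proof. by move=> lL; rewrite -(loops_coset_type lL) h_coefP. Qed.

Definition realizable n := forall s, all (fun p => 0 < p)%N s -> sumn s = n ->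
  exists (sg : {perm pt n}) L, loops (mt sg) L /\ map size L = s.

(* A loop of length at least 2 through the last point arises from a loop of
   S_n by multiplication with one transposition. *)
Lemma realizable_top n m s : realizable n -> all (fun p => 0 < p)%N s ->
  (m + sumn s = n)%N ->
  exists (sg : {perm pt n.+1}) c R,
    [/\ loops (mt sg) (((ord_max, false) :: c) :: R), size c = m, map size R = s
      & forall k, hcoef n k (mt sg) =
                  if m is 0 then h_coef k (sort geq s) else 0].
Proof.
(* The loop through the last point has length [m.+1], so [m = 0] is the case of the Kronecker
   delta. *)
move=> rz ps; case: m => [|m] sn.
  have [sg [L [lL sL]]] := rz s ps sn.
  exists (ext_perm sg), [::], (map (map (@up n)) L).
  split; rewrite ?map_size_up //; first exact: loops_ext.
  move=> k; rewrite -sL -(hcoef_loops _ lL); apply: hcoef_up => // [x|b].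
    exact: mt_ext_up.
  exact: mt_ext_top.
have [sg [L [lL]]] := rz (m.+1 :: s) ps sn.
case: L lL => [|[|y c] R] //= lL [sc sR].
have lL' := loops_ext_merge lL.
exists (ext_perm sg * tperm (ord_max, false) (up y))%g, (up y :: map (@up n) c),
  (map (map (@up n)) R).
split; rewrite ?map_size_up //= ?size_map ?sc // => k.
(* The bar of the last point is now matched with [up y] and not with the last point. *)
apply: (@hcoef_eq0 _ _ _ _ ord_max) => //.
case/and3P: lL' => _ /=; case/andP=> /andP[/eqP e _] _ _; rewrite -/(step _ _) e.
by rewrite xpair_eqE eq_sym (negPf (neq_lift _ _)).
Qed.

Lemma loops_realize n : realizable n.
Proof.
elim: n => [|n IH] s ps sn.
  exists 1%g, [::]; case: s ps sn => [|p s] /=; last by case: p.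
  by move=> _ _; split=> //; rewrite /loops /= (size0nil (size_enum_ord 0)).
case: s ps sn => [|[|m] s] //= ps [sn].
have [sg [c [R [lL sc sR _]]]] := realizable_top IH ps sn.
by exists sg, (((ord_max, false) :: c) :: R); rewrite /= sc sR.
Qed.

(** * The sum over the transpositions that move the last point *)

Lemma sum_half n (Y : seq (pt n)) (F : pt n -> rat) : transversal_pts Y ->
  \sum_x F x = \sum_(y <- Y) (F y + F (bar y)).
Proof.
move=> hY; rewrite big_split /= -(big_map (@bar n) xpredT F) -big_cat /=.
apply: perm_big; apply: uniq_perm; first exact: index_enum_uniq.
  rewrite cat_uniq (transversal_uniq hY)
    (map_inj_uniq (inv_inj (@barK n))) (transversal_uniq hY) andbT.
  by apply/hasPn=> _ /mapP[y yY ->]; rewrite transversal_bar // negbK.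
move=> x; rewrite mem_index_enum mem_cat -{2}[x]barK.
by rewrite (mem_map (inv_inj (@barK n))) transversal_bar // orbN.
Qed.

Lemma loops_merge_at n (t : {perm pt n}) a A R c x : matching t ->
  loops t ((a :: A) :: R) -> c \in R -> (x \in c) || (bar x \in c) ->
  exists L, loops (t ^ tperm x a)%g L /\
    perm_eq (map size L) (((size A).+1 + size c)%N :: map size (rem c R)).
Proof.
move=> mt1 lL cR xc; rewrite tpermC.
have pL : perm_eq ((a :: A) :: R) (c :: (a :: A) :: rem c R).
  apply: perm_trans (permEl (perm_catCA [:: a :: A] [:: c] _)).
  by rewrite perm_cons perm_to_rem.
have [c' [xc' sc' lL']] : exists c', [/\ x \in c', size c' = size c &
    loops t (c' :: (a :: A) :: rem c R)].
  have lL' : loops t (c :: (a :: A) :: rem c R) by rewrite -(loops_perm _ pL).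
  case/orP: xc => xc; first by exists c.
  exists (rev (map (@bar n) c)); split; last exact: loops_flip.
    by rewrite mem_rev -[x]barK map_f.
  by rewrite size_rev size_map.
have [i B e] := rot_to xc'; have := loops_rot i lL'; rewrite e => lB.
have sB : (size B).+1 = size c by rewrite -sc' -(size_rot i c') e.
exists ((a :: A ++ x :: B) :: rem c R); split; last by rewrite /= size_cat /= sB addSn.
apply: loops_merge.
by rewrite -(loops_perm _ (permEl (perm_catCA [:: x :: B] [:: a :: A] _))).
Qed.

Lemma sort_geq_perm s1 s2 : perm_eq s1 s2 -> sort geq s1 = sort geq s2.
Proof.
move/perm_sortP; apply.
- by move=> i j; apply: leq_total.
- by move=> i j k; rewrite /geq /= => h1 h2; apply: leq_trans h2 h1.
- by move=> i j; rewrite andbC -eqn_leq => /eqP.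
Qed.

Lemma perm_map_rem (T U : eqType) (f : T -> U) x s : x \in s ->
  perm_eq (map f (rem x s)) (rem (f x) (map f s)).
Proof.
move=> xs; rewrite -(perm_cons (f x)); have fx := map_f f xs.
rewrite -(permPr (perm_to_rem fx)); rewrite -map_cons perm_sym.
exact: perm_map (perm_to_rem xs).
Qed.

(** The points are grouped in pairs [y], [bar y] along the loops. On another loop of length p every
    point merges the two loops, which gives 2 p equal terms; on the loop of the last point, [y]
    splits it and [bar y] turns a segment. *)
Lemma sum_transpositions n k (sg : {perm pt n.+1}) c R :
  loops (mt sg) (((ord_max, false) :: c) :: R) ->
  \sum_(x : pt n.+1 | (x.1 < n)%N)
     hcoef n.+1 k (mt sg ^ tperm x (ord_max, false))%g =
  2 * (\sum_(p <- map size R) p%:R *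
         h_coef k (sort geq (((size c).+1 + p)%N :: rem p (map size R))))
  + \sum_(i < size c) h_coef k (sort geq [:: i.+1, (size c - i)%N & map size R])
  + (size c)%:R * h_coef k (sort geq ((size c).+1 :: map size R)).
Proof.
set a := (ord_max, false) => lL; have mt1 := mt_matching sg.
pose F x := hcoef n.+1 k (mt sg ^ tperm x a)%g.
have hF x L : loops (mt sg ^ tperm x a)%g L -> F x = h_coef k (sort geq (map size L)).
  by rewrite /F -mtM => /hcoef_loops ->.
have hY : transversal_pts (flatten ((a :: c) :: R)) by case/and3P: lL.
have uY := loops_uniq lL.
(* The last point and its bar have index n and drop out. *)
rewrite big_mkcond (sum_half _ hY) /= big_cons ltnn addr0 add0r.
have lt y : y \in c ++ flatten R -> (y.1 < n)%N.
  move=> yL; have yn : y.1 != ord_max.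
    by apply: contraTneq uY => yn; rewrite /= -yn map_f.
  by move: yn (ltn_ord y.1); rewrite -(inj_eq val_inj) /= ltnS leq_eqVlt => /negPf->.
rewrite (eq_big_seq (fun y => F y + F (bar y))) => [|y /lt /= ->] //.
rewrite big_cat /= addrC -addrA; congr (_ + _).
  rewrite big_map mulr_sumr big_flatten; apply: eq_big_seq => d dR.
  rewrite (eq_big_seq (fun=> 2 * h_coef k (sort geq (((size c).+1 + size d)%N
      :: rem (size d) (map size R))))) => [|y yd].
    rewrite big_const_seq count_predT iter_addr_0.
    by rewrite -mulrnAr; congr (_ * _); rewrite mulr_natl.
  have FE x : (x \in d) || (bar x \in d) -> F x = h_coef k (sort geq
      (((size c).+1 + size d)%N :: rem (size d) (map size R))).
    move=> xd; have [L [lL' pL]] := loops_merge_at mt1 lL dR xd.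
    rewrite (hF _ _ lL'); congr (h_coef k _); apply: sort_geq_perm.
    by apply: perm_trans pL _; rewrite perm_cons perm_map_rem.
  by rewrite !FE ?barK ?yd ?orbT // mulr_natl.
rewrite big_split /=; congr (_ + _).
  (* Splitting at position [i] of [c] leaves [a] with the [i] points before it, hence the lengths
     [i.+1] and [size c - i]. *)
  rewrite (big_nth a) big_mkord; apply: eq_bigr => i _.
  have e := cat_take_drop i c; rewrite (drop_nth a) // in e; rewrite -e in lL.
  have := loops_split lL; rewrite tpermC => /hF ->.
  by rewrite /= size_take size_drop ltn_ord subnSK.
rewrite (eq_big_seq (fun=> h_coef k (sort geq ((size c).+1 :: map size R)))) => [|y yc].
  by rewrite big_const_seq count_predT iter_addr_0 mulr_natl.
case/splitPr: yc lL {hY uY lt} => A B lL.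
have := loops_turn mt1 lL; rewrite tpermC => /hF ->.
by rewrite /= !size_cat /= size_rev size_map.
Qed.

Lemma sum_pairs m (F : nat -> nat -> rat) :
  \sum_(rs : 'I_m.+2 * 'I_m.+2 | [&& (0 < rs.1)%N, (0 < rs.2)%N & (rs.1 + rs.2)%N == m.+1])
     F rs.1 rs.2 = \sum_(i < m) F i.+1 (m - i)%N.
Proof.
pose h (i : 'I_m) : 'I_m.+2 * 'I_m.+2 := (inord i.+1, inord (m - i)).
rewrite (reindex_omap h (fun rs => insub rs.1.-1)) => [|[r s] /= /and3P[r0 s0 /eqP e]].
  have hi (i : 'I_m) : (h i).1 = i.+1 :> nat /\ (h i).2 = (m - i)%N :> nat.
    by rewrite /h /= !inordK // ?ltnS ?(ltnW (ltn_ord i)) // -ltnS ltnS ltnW // ltnS leq_subr.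
  apply: eq_big => [i|i _]; last by case: (hi i) => -> ->.
  case: (hi i) => -> ->; rewrite /= valK eqxx andbT subn_gt0 ltn_ord /=.
  by rewrite addSn subnKC ?eqxx // ltnW.
have [rm sm] : (r.-1 < m)%N /\ (m - r.-1)%N = s.
  move: r0 s0 e; case: (nat_of_ord r) => // r' _; case: (nat_of_ord s) => // s' _.
  by move=> [<-]; rewrite addKn addnS ltnS leq_addr.
rewrite insubT /=; congr (Some (_, _)); apply/val_inj; rewrite /= inordK ?sm //.
  exact: prednK.
by rewrite ltnS ltnW.
Qed.

Theorem theorem3p5 (rho : seq nat) (k m : nat)
    (rho_part : is_part rho) (k_gt0 : (0 < k)%N) (m_gt0 : (0 < m)%N) :
  h_coef k (padd rho [:: m]) =
    (m == 1%N)%:R * h_coef k rho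
    + 2 * (\sum_(i < size rho)
            (nth 0%N rho i)%:R
            * h_coef k.-1 (padd (prem rho (nth 0%N rho i)) [:: (nth 0%N rho i + m)%N]))
    + \sum_(rs : 'I_m.+1 * 'I_m.+1 | [&& (0 < rs.1)%N, (0 < rs.2)%N & (rs.1 + rs.2)%N == m])
        h_coef k.-1 (padd rho [:: (rs.1 : nat); (rs.2 : nat)])
    + m.-1%:R * h_coef k.-1 (padd rho [:: m]).
Proof.
case: k k_gt0 => // k _; case: m m_gt0 => // m _ /=.
have /andP[srt pos] := rho_part.
(* From here on [m] is the original m minus one. The chosen permutation has a loop of length [m.+1]
   through the last point and further loops with the lengths in [rho]. *)
have [sg [c [R [lL sc sR hn]]]] :=
  realizable_top (@loops_realize (m + sumn rho)) pos erefl.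
have -> : h_coef k.+1 (padd rho [:: m.+1]) = hcoef (m + sumn rho).+1 k.+1 (mt sg).
  by rewrite (hcoef_loops _ lL) /= sc sR.
(* The function h_(k+1) is split at its last variable: [hn] gives the Kronecker term and
   [sum_transpositions] the rest. *)
rewrite -[(m + sumn rho)%N]/(val (@ord_max (m + sumn rho))) hcoefS hn.
rewrite (sum_transpositions _ lL) sc sR !addrA; congr (_ + _ + _ + _).
- case: (m) => [|?]; rewrite ?mul0r // mul1r sorted_sort //.
  by move=> x y z /= h1 h2; apply: leq_trans h2 h1.
- rewrite (big_nth 0%N) big_mkord; congr (2 * _); apply: eq_bigr => i _.
  by rewrite addnC.
- by rewrite (sum_pairs _ (fun r s => h_coef k (padd rho [:: r; s]))).
Qed.
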